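(* The class of polynomial vector fields satisfying the WDG condition is not closed under polynomial automorphisms, not even under elementary transformations: there exist $n$, a vector field $f\in\mathcal{W}_n$ and an elementary transformation $\phi:\mathbb{R}^n\to\mathbb{R}^n$ such that the vector field $h(y)=D\phi_{\phi^{-1}(y)}f(\phi^{-1}(y))$, obtained from $\dot x=f(x)$ by the change of variables $y=\phi(x)$, does not belong to $\mathcal{W}_n$.
   Context: For a vector field $f$ on $\mathbb{R}^n$, $e^{tf}x_0$ denotes the value at time $t$ of the solution of $\dot x = f(x)$, $x(0)=x_0$. For $m\ge n$, $\Pi_n:\mathbb{R}^m\to\mathbb{R}^n$ is the projection on the first $n$ coordinates. $D\phi_x$ is the Jacobian matrix of $\phi$ at $x$. An elementary transformation of $\mathbb{R}^n$ is a map $x\mapsto (x_1,\ldots,x_{n-1},x_n+g(x_1,\ldots,x_{n-1}))$ with $g$ a real polynomial of degree greater than 1. Super-linearizable: a polynomial vector field $f:\mathbb{R}^n\to\mathbb{R}^n$ is super-linearizable if there exist $k$, a polynomial map $p:\mathbb{R}^n\to\mathbb{R}^k$ and a matrix $B\in\mathbb{R}^{(n+k)\times(n+k)}$ such that for all $x_0\in\mathbb{R}^n$ and all $t\ge 0$, $\Pi_n(e^{Bt}z_0)=e^{tf}x_0$, where $z_0=(x_0,p(x_0))$. Weighted dependency graph (WDG): to a polynomial vector field $f$ on $\mathbb{R}^n$ associate the directed graph on nodes $v_1,\ldots,v_n$ with edge set $\{v_iv_j : \partial f_i/\partial x_j \not\equiv 0\}$ (self-loops allowed), the edge $v_iv_j$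 having weight the polynomial $\partial f_i/\partial x_j$. $f$ satisfies the WDG condition if, for every directed cycle (including self-loops) of this graph, the product of the edge weights along the cycle is a constant. $\mathcal{W}_n$ is the set of super-linearizable polynomial vector fields on $\mathbb{R}^n$ that satisfy the WDG condition. *)

(* Defs.v *)
From HB Require Import structures.
From mathcomp Require Import all_boot all_order all_algebra.
From mathcomp Require Import all_classical all_reals all_analysis.
(* The notations of mpoly clash with those of the
   analysis library. *)
From mathcomp Require Import -(notations) mpoly.

Set Implicit Arguments.
Unset Strict Implicit.
Unset Printing Implicit Defensive.

Import Order.TTheory GRing.Theory Num.Theory.
Import numFieldNormedType.Exports.

Local Open Scope classical_set_scope.
Local Open Scope ring_scope.

Section Definitions.
Variable R : realType.

Definition polymap (n m : nat) := 'cV[mpoly n R]_m.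

Definition ev n (v : 'cV[R]_n) (p : mpoly n R) : R :=
  meval (fun i => v i 0) p.

Definition pmeval n m (F : polymap n m) (v : 'cV[R]_n) : 'cV[R]_m :=
  map_mx (ev v) F.

Definition jacobian_at n m (F : polymap n m) (v : 'cV[R]_n) : 'M[R]_(m, n) :=
  \matrix_(i, j) ev v (mderiv j (F i 0)).

(* [flow f t x0 x1], for t >= 0, means that e^{tf} x0 is defined and equal to
   x1. Solutions of a polynomial vector field may blow up in finite time, hence
   a relation. Asking for a two-sided derivative at the endpoints 0 and t is no
   restriction, as a solution on [0, t] extends affinely on both sides. *)
Definition flow n (f : polymap n n) (t : R) (x0 x1 : 'cV[R]_n) : Prop :=
  exists x : R -> 'cV[R]_n,
    [/\ x 0 = x0,
        x t = x1
      & forall s : R, 0 <= s <= t -> is_derive s 1 x (pmeval f (x s))].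

Definition expmx n (A : 'M[R]_n) : 'M[R]_n :=
  limn (series (fun k : nat => (k`!%:R)^-1 *: A ^+ k)).

Definition super_linearizable n (f : polymap n n) : Prop :=
  exists (k : nat) (p : polymap n k) (B : 'M[R]_(n + k)),
    forall (x0 : 'cV[R]_n) (t : R), 0 <= t ->
      flow f t x0 (usubmx (expmx (t *: B) *m col_mx x0 (pmeval p x0))).

Definition wdg_weight n (f : polymap n n) (i j : 'I_n) : mpoly n R :=
  mderiv j (f i 0).

Definition wdg_edge n (f : polymap n n) : rel 'I_n :=
  fun i j => wdg_weight f i j != 0.

(* A directed cycle is the nonempty sequence s of its (distinct) nodes; a
   self-loop at i is [:: i], for which [next [:: i] i = i]. *)
Definition wdg_condition n (f : polymap n n) : Prop :=
  forall s : seq 'I_n, s != [::] -> ucycle (wdg_edge f) s ->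
    exists c : R, \prod_(i <- s) wdg_weight f i (next s i) = mpolyC n c.

Definition in_W n (f : polymap n n) : Prop :=
  super_linearizable f /\ wdg_condition f.

Definition poly_automorphism n (phi : polymap n n) : Prop :=
  exists psi : polymap n n,
    cancel (pmeval phi) (pmeval psi) /\ cancel (pmeval psi) (pmeval phi).

(* [mpoly.msize g] is 1 + the degree of g. *)
Definition elementary n (phi : polymap n.+1 n.+1) : Prop :=
  exists g : mpoly n R, (2 < mpoly.msize g)%N /\
    forall (x : 'cV[R]_n.+1) (i : 'I_n.+1),
      pmeval phi x i 0 =
        x i 0 + (if i == ord_max then
                   meval (fun j => x (widen_ord (leqnSn n) j) 0) g
                 else 0).

(* [h] is the vector field obtained from [f] by the change of variables
   y = phi(x); [inv] is the inverse of [phi]. *)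
Definition change_of_variables n (phi f h : polymap n n) : Prop :=
  exists inv : 'cV[R]_n -> 'cV[R]_n,
    [/\ cancel (pmeval phi) inv,
        cancel inv (pmeval phi)
      & forall y : 'cV[R]_n,
          pmeval h y = jacobian_at phi (inv y) *m pmeval f (inv y)].

End Definitions.

(* Main.v *)
Require Import Defs.
From mathcomp Require Import all_boot all_order all_algebra.
From mathcomp Require Import all_classical all_reals all_analysis.
From mathcomp Require Import -(notations) mpoly.
From mathcomp Require Import ring lra.

Set Implicit Arguments.
Unset Strict Implicit.
Unset Printing Implicit Defensive.

Import GRing.Theory Num.Theory numFieldNormedType.Exports.

Local Open Scope ring_scope.

(** The linear field x' = y, y' = 0 has constant weights, and its matrix squares
    to zero, so that its flow is (x + t y, y). In the coordinates
    (x, y + x ^ 2) its first component becomes y - x ^ 2, and the self-loop at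
    the first node then has the weight - 2 x, which is not constant. *)

Lemma ord2P (i : 'I_2) : i = ord0 \/ i = ord_max.
Proof. by case: i => [[|[|//]]] ?; [left|right]; apply: val_inj. Qed.

Lemma cV2P (T : Type) (u v : 'cV[T]_2) :
  u ord0 0 = v ord0 0 -> u ord_max 0 = v ord_max 0 -> u = v.
Proof.
by move=> e0 e1; apply/colP => i; have [->|->] := ord2P i.
Qed.

Definition pair_col (T : Type) (a b : T) : 'cV[T]_2 :=
  \col_i if i == ord0 then a else b.

Section Polynomials.
Variable R : realType.

Definition var (n : nat) (i : 'I_n) : mpoly n R := mpolyX R (mnm1 i).

Section Evaluation.
Context (n : nat) (v : 'cV[R]_n).

(** These are the evaluation rules of [meval], restated for the constant [ev] so that rewriting
    finds them under [pmeval]. *)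
Lemma ev_var i : ev v (var i) = v i 0. Proof. exact: mevalXU. Qed.
Lemma evC c : ev v (mpolyC n c) = c. Proof. exact: mevalC. Qed.
Lemma ev0 : ev v 0 = 0. Proof. exact: meval0. Qed.
Lemma evD : {morph ev v : p q / p + q}. Proof. exact: mevalD. Qed.
Lemma evN : {morph ev v : p / - p}. Proof. exact: mevalN. Qed.
Lemma evM : {morph ev v : p q / p * q}. Proof. exact: mevalM. Qed.

Definition evE := (ev_var, evC, ev0, evD, evN, evM).

End Evaluation.

Lemma mderiv_var n (i j : 'I_n) : mderiv j (var i) = mpolyC n (i == j)%:R.
Proof.
rewrite /var mderivX mnm1E; case: eqP => [->|_].
  (* Writing the exponent as [0 + mnm1 j] lets [addmK] cancel it, which leaves the monomial of
     exponent zero. *)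
  by rewrite scale1r -[mnm1 j in X in mnm_sub X]add0m addmK mpolyX0 mpolyC1.
by rewrite scale0r mpolyC0.
Qed.

(** Since [mpolyC] is a ring morphism, a product of constants is constant, and no cycle has to be
    examined. *)
Lemma wdg_condition_const_weight n (f : polymap R n n) (c : 'I_n -> 'I_n -> R) :
  (forall i j, wdg_weight f i j = mpolyC n (c i j)) -> wdg_condition f.
Proof.
move=> fc s _ _; exists (\prod_(i <- s) c i (next s i)).
by rewrite rmorph_prod; apply: eq_bigr => i _; rewrite fc.
Qed.

(** A nonzero weight makes [[:: i]] a cycle whose product is that one weight; a zero weight is
    constant anyway. *)
Lemma self_loop_const n (f : polymap R n n) (i : 'I_n) :
  wdg_condition f -> exists c, wdg_weight f i i = mpolyC n c.
Proof.
move=> fwdg; have [w0|wn0] := eqVneq (wdg_weight f i i) 0.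
  by exists 0; rewrite mpolyC0.
have [//||c] := fwdg [:: i]; first by rewrite /ucycle /= /wdg_edge wn0.
by rewrite big_seq1 /= eqxx => ->; exists c.
Qed.

End Polynomials.

Section Exponential.
Variable R : realType.

(** All powers from the second on vanish, so the partial sums of the series are eventually
    constant. *)
Lemma expmx_square_zero n (A : 'M[R]_n) : A *m A = 0 -> expmx A = 1%:M + A.
Proof.
move=> A0; apply: lim_near_cst; first exact: norm_hausdorff.
near=> m; have m2 : (2 <= m)%N by near: m; exact: nbhs_infty_ge.
rewrite /series /= (big_cat_nat (n := 2)) //= big_nat_recl // big_nat1 /=.
rewrite big_nat_cond big1 ?addr0 => [|k /andP[/andP[k2 _] _]]; last first.
  by rewrite -(subnKC k2) exprD expr2 [A * A]A0 mul0r scaler0.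
by rewrite !invr1 !scale1r expr0 expr1.
Unshelve. all: by end_near. Qed.

(** The difference quotient equals [v] for every nonzero increment. *)
Lemma is_derive_affine (V : normedModType R) (a v : V) (s : R) :
  is_derive s (1 : R) (fun r : R => a + r *: v) v.
Proof.
suff Dv : (h^-1 *: (((fun r => a + r *: v) \o shift s) (h *: 1) -
                   (a + s *: v)) @[h --> 0^'] --> v)%classic.
  by split; [exact: cvgP Dv|exact: cvg_lim Dv].
apply: cvg_near_cst; near=> h; have h0 : h != 0 by near: h; exact: nbhs_dnbhs_neq.
rewrite /= scaler1 opprD addrACA subrr add0r -scalerBl addrK.
by rewrite scalerA mulVf // scale1r.
Unshelve. all: by end_near. Qed.

(** The line has constant velocity [v], which is also the value of [f] all along it, so it solves
    the equation. *)
Lemma flow_affine n (f : polymap R n n) (x0 v : 'cV[R]_n) (t : R) :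
  (forall s, pmeval f (x0 + s *: v) = v) -> flow f t x0 (x0 + t *: v).
Proof.
move=> fv; exists (fun s => x0 + s *: v); split=> //.
  by rewrite scale0r addr0.
by move=> s _; rewrite fv; exact: is_derive_affine.
Qed.

End Exponential.

Section Counterexample.
Variable R : realType.

Local Notation X := (@var R 2 ord0).
Local Notation Y := (@var R 2 ord_max).

Definition drift : polymap R 2 2 := pair_col Y 0.
Definition shear : polymap R 2 2 := pair_col X (Y + X * X).
Definition unshear : polymap R 2 2 := pair_col X (Y - X * X).
(** The Jacobian of [shear] has rows (1, 0) and (2x, 1) and sends (y, 0) to (y, 2xy); then y is
    replaced by [Y - X * X]. *)
Definition sheared_drift : polymap R 2 2 :=
  pair_col (Y - X * X) ((X + X) * (Y - X * X)).

Lemma shearK : cancel (pmeval shear) (pmeval unshear).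
Proof. by move=> v; apply: cV2P; rewrite !(mxE, evE) /= ?addrK. Qed.

Lemma unshearK : cancel (pmeval unshear) (pmeval shear).
Proof. by move=> v; apply: cV2P; rewrite !(mxE, evE) /= ?subrK. Qed.

Lemma shear_automorphism : poly_automorphism shear.
Proof. by exists unshear; split; [exact: shearK|exact: unshearK]. Qed.

Lemma shear_elementary : elementary (n := 1) shear.
Proof.
(* The square of the single variable has degree 2, hence [msize] 3. *)
exists (mpolyX R (mnm_muln (mnm1 ord0) 2)); split.
  by rewrite msizeX mdegMn mdeg1.
move=> v i; rewrite -mpolyXn expr2 mevalM mevalXU.
rewrite !mxE; have [->|->] := ord2P i; rewrite !evE ?addr0 //.
by rewrite (_ : widen_ord _ _ = ord0) //; apply: val_inj.
Qed.

Lemma shear_drift : change_of_variables shear drift sheared_drift.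
Proof.
exists (pmeval unshear); split; [exact: shearK|exact: unshearK|].
move=> v; apply: cV2P; rewrite !mxE big_ord_recl big_ord1 !mxE /=;
  rewrite ?(mderivD, mderivM) !mderiv_var /= !(evE, mxE) /=; ring.
Qed.

Lemma drift_wdg : wdg_condition drift.
Proof.
(* The constants are the Jacobian entries of [drift]: the only edge goes from the first node to the
   second, with weight 1. *)
apply: (@wdg_condition_const_weight _ _ _
  (fun i j => ((i == ord0) && (j == ord_max))%:R)) => i j.
rewrite /wdg_weight mxE; case: eqP => _ /=; first by rewrite mderiv_var eq_sym.
by rewrite mderiv0 mpolyC0.
Qed.

Lemma sheared_drift_wdg : ~ wdg_condition sheared_drift.
Proof.
move=> /(@self_loop_const _ _ _ ord0)[c].
rewrite /wdg_weight mxE /= mderivB mderivM !mderiv_var /= => wc.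
(* Evaluating the weight at the point with all coordinates [a] gives -2a = c for every a; the values
   0 and 1 are incompatible. *)
have ev_c a : - (a + a) = c.
  by have := congr1 (ev (const_mx a)) wc; rewrite !(mxE, evE) mul1r mulr1 sub0r.
by have := ev_c 0; have := ev_c 1; lra.
Qed.

Lemma drift_super_linearizable : super_linearizable drift.
Proof.
pose N : 'M[R]_2 := delta_mx ord0 ord_max.
(* The field is linear, so no coordinate is adjoined; the empty blocks only give [N] the size
   [2 + 0]. *)
pose B : 'M[R]_(2 + 0) := block_mx N 0 0 0.
have B2 : B *m B = 0.
  by rewrite mulmx_block !(mulmx0, mul0mx, addr0) mul_delta_mx_0 // block_mx0.
exists 0%N, 0, B => x0 t _.
set z0 := col_mx x0 _.
have Bz0 : usubmx (B *m z0) = pair_col (x0 ord_max 0) 0.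
  rewrite mul_block_col !mul0mx !addr0 col_mxKu.
  apply: cV2P; rewrite !mxE big_ord_recl big_ord1 !mxE /=.
    by rewrite mul0r add0r mul1r; congr (x0 _ _); apply: val_inj.
  by rewrite !mul0r addr0.
(* The exponential is 1 + tB, so the projected curve is a line in t; its second coordinate stays
   fixed, and [drift] is constant along it. *)
rewrite expmx_square_zero; last by rewrite -scalemxAl -scalemxAr B2 !scaler0.
rewrite mulmxDl mul1mx -scalemxAl linearD linearZ /= Bz0 col_mxKu.
apply: flow_affine => s.
by apply: cV2P; rewrite !(mxE, evE) /= ?mulr0 ?addr0.
Qed.

End Counterexample.

Theorem mainTheorem4 (R : realType) :
  [/\ ~ (forall (n : nat) (f phi h : polymap R n n),
           poly_automorphism phi -> change_of_variables phi f h ->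
           wdg_condition f -> wdg_condition h),
      ~ (forall (n : nat) (f phi h : polymap R n.+1 n.+1),
           elementary phi -> change_of_variables phi f h ->
           wdg_condition f -> wdg_condition h)
    & exists (n : nat) (f phi h : polymap R n.+1 n.+1),
        [/\ in_W f, elementary phi, change_of_variables phi f h & ~ in_W h]].
Proof.
split.
- move=> /(_ _ _ _ _ (shear_automorphism R) (shear_drift R) (@drift_wdg R)).
  exact: sheared_drift_wdg.
- move=> /(_ _ _ _ _ (shear_elementary R) (shear_drift R) (@drift_wdg R)).
  exact: sheared_drift_wdg.
exists 1%N, (drift R), (shear R), (sheared_drift R); split.
- by split; [exact: drift_super_linearizable|exact: drift_wdg].
- exact: shear_elementary.
- exact: shear_drift.
(* Membership fails through the WDG condition. *)
- by case=> _ /sheared_drift_wdg.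
Qed.
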